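(* In the symmetric-ordering setup, for all $f\in S(\mathfrak g)$ and all indices $\mu,\nu$, $$M_\mu(x_\nu\star f)-x_\nu\star(M_\mu f)=\Big(\sum_\lambda C^\lambda_{\mu\nu}x_\lambda\Big)f+\sum_\tau M_\tau\big(\chi^\tau_{\mu\nu}f\big),$$ where $$\chi^\tau_{\mu\nu}=\sum_{N\ge1}(-1)^N\frac{B_N}{N!}\Big[\sum_\alpha C^\tau_{\mu\alpha}(\mathbb C^{N-1})^\alpha_\nu-\sum_\alpha\frac{\partial(\mathbb C^{N-1})^\tau_\nu}{\partial(\partial^\alpha)}\,\mathbb C^\alpha_\mu\Big]\in\Bbbk[[\partial^1,\ldots,\partial^n]].$$
   Context: Symmetric-ordering setup: $\Bbbk$ is a field of characteristic $0$, $\mathfrak g$ an $n$-dimensional Lie algebra with basis $\hat x_1,\ldots,\hat x_n$ and $[\hat x_i,\hat x_j]=\sum_kC^k_{ij}\hat x_k$. $S(\mathfrak g)=\Bbbk[x_1,\ldots,x_n]$; $\partial^\mu$ acts on $S(\mathfrak g)$ as $\partial/\partial x_\mu$ and formal power series in the $\partial$'s act as constant-coefficient differential operators. The coexponential map $\xi:S(\mathfrak g)\to U(\mathfrak g)$ is the linear isomorphism $\xi(x_{\alpha_1}\cdots x_{\alpha_k})=\frac1{k!}\sum_{\sigma\in\Sigma_k}\hat x_{\alpha_{\sigma(1)}}\cdots\hat x_{\alpha_{\sigma(k)}}$, and $f\star g=\xi^{-1}(\xi(f)\xi(g))$. $M_\tau:=\sum_{\lambda,\rho}C^\lambda_{\tau\rho}x_\lambda\partial^\rho$,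 an operator on $S(\mathfrak g)$. $\mathbb C$ is the $n\times n$ matrix with entries $\mathbb C^\alpha_\beta=\sum_\rho C^\alpha_{\beta\rho}\partial^\rho$, $(\mathbb C^N)^\alpha_\beta$ entries of its $N$-th power (upper index = row, $\mathbb C^0$ the identity). Bernoulli numbers: $t/(e^t-1)=\sum B_Nt^N/N!$ ($B_1=-1/2$). *)

(* Defs.v *)
From HB Require Import structures.
From mathcomp Require Import all_boot all_order all_fingroup all_algebra.
Set Implicit Arguments. Unset Strict Implicit. Unset Printing Implicit Defensive.
Import Order.TTheory GRing.Theory Num.Theory.
Local Open Scope ring_scope.

(* ---------- Polynomials in n commuting variables (iterated univariate) ----
   mpoly R n = R[y_0,...,y_{n-1}], built as R[y_0][y_1]...[y_{n-1}]:
   mpoly R (n+1) = {poly mpoly R n}, the outer indeterminate 'X being y_n. *)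
Fixpoint mpoly (R : comNzRingType) (n : nat) : comNzRingType :=
  match n with
  | 0 => R
  | n'.+1 => GRing.ComNzRing.clone _ {poly (mpoly R n')}
  end.

Section MPoly.
Variable R : comNzRingType.

Fixpoint mpC (n : nat) : R -> mpoly R n :=
  match n return R -> mpoly R n with
  | 0 => fun c => c
  | n'.+1 => fun c => (@mpC n' c)%:P
  end.

(* the variable y_i (i < n); 0 if i >= n *)
Fixpoint mpX (n : nat) (i : nat) : mpoly R n :=
  match n return mpoly R n with
  | 0 => 0
  | n'.+1 => if i == n' then 'X else (@mpX n' i)%:P
  end.

Fixpoint mpD (n : nat) (i : nat) : mpoly R n -> mpoly R n :=
  match n return mpoly R n -> mpoly R n with
  | 0 => fun _ => 0
  | n'.+1 => fun p => if i == n' then deriv p else map_poly (@mpD n' i) p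
  end.

(* Action of a constant-coefficient differential operator d in R[d_0..d_{n-1}]
   (the variable d_i acting as d/dy_i) on a polynomial f in R[y_0..y_{n-1}]. *)
Fixpoint mpact (n : nat) : mpoly R n -> mpoly R n -> mpoly R n :=
  match n return mpoly R n -> mpoly R n -> mpoly R n with
  | 0 => fun d f => d * f
  | n'.+1 => fun d f =>
      \sum_(j < size d) map_poly (@mpact n' d`_j) (derivn j f)
  end.

Fixpoint mcoef (n : nat) : mpoly R n -> (nat -> nat) -> R :=
  match n return mpoly R n -> (nat -> nat) -> R with
  | 0 => fun c _ => c
  | n'.+1 => fun p e => @mcoef n' (p`_(e n')) e
  end.

(* a bound: every monomial of f has all exponents < msize f *)
Fixpoint msize (n : nat) : mpoly R n -> nat :=
  match n return mpoly R n -> nat with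
  | 0 => fun _ => 1%N
  | n'.+1 => fun p => maxn (size p) (\max_(j < size p) @msize n' p`_j)
  end.

End MPoly.

Section Xi.
Variables (k : fieldType) (n : nat) (A : algType k) (iota : 'I_n -> A).

Definition mword (e : 'I_n -> nat) : seq 'I_n :=
  flatten [seq nseq (e j) j | j : 'I_n].

Definition symword (w : seq 'I_n) : A :=
  ((size w)`!%:R)^-1 *:
    \sum_(s : 'S_(size w)) \prod_(j < size w) iota (tnth (in_tuple w) (s j)).

Definition expo_of (B : nat) (e : {ffun 'I_n -> 'I_B}) : nat -> nat :=
  fun i => nth 0%N [seq nat_of_ord (e j) | j : 'I_n] i.

Definition xi (f : mpoly k n) : A :=
  \sum_(e : {ffun 'I_n -> 'I_(msize f)})
     mcoef f (expo_of e) *: symword (mword (fun j => nat_of_ord (e j))).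

Definition is_star (f g h : mpoly k n) : Prop := xi h = xi f * xi g.

End Xi.

Section Ops.
Variables (k : fieldType) (n : nat) (C : 'I_n -> 'I_n -> 'I_n -> k).
(* C l i j = C^l_{ij}, i.e. [x_i, x_j] = sum_l C^l_{ij} x_l *)

(* the generator x_i of S(g) = k[x_1..x_n] (also used for d^i in k[d^1..d^n]) *)
Definition var (i : 'I_n) : mpoly k n := mpX k n i.
Definition sc (c : k) : mpoly k n := mpC n c.
Definition pd (i : 'I_n) (f : mpoly k n) : mpoly k n := mpD i f.

Definition Mop (tau : 'I_n) (f : mpoly k n) : mpoly k n :=
  \sum_(l < n) \sum_(r < n) sc (C l tau r) * var l * pd r f.

Definition Cmat : 'M[mpoly k n]_n :=
  \matrix_(a < n, b < n) \sum_(r < n) sc (C a b r) * var r.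

Definition chi_term (N : nat) (tau mu nu : 'I_n) : mpoly k n :=
  \sum_(a < n) sc (C tau mu a) * (Cmat ^+ N.-1) a nu
  - \sum_(a < n) pd a ((Cmat ^+ N.-1) tau nu) * Cmat a mu.

Definition chi_trunc (B : nat -> k) (K : nat) (tau mu nu : 'I_n) : mpoly k n :=
  \sum_(1 <= N < K.+1) sc ((-1) ^+ N * B N / (N`!)%:R) * chi_term N tau mu nu.

End Ops.

(* Bernoulli numbers via t/(e^t - 1) = sum_N B_N t^N / N!, i.e.
   (sum_N B_N t^N/N!) * (sum_i t^i/(i+1)!) = 1, coefficientwise. *)
Definition is_bernoulli (k : fieldType) (B : nat -> k) : Prop :=
  forall m : nat,
    \sum_(j < m.+1) B j / ((j`!)%:R * ((m - j).+1`!)%:R) = (m == 0%N)%:R.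

(* Main.v *)
Require Import Defs.
From HB Require Import structures.
From mathcomp Require Import all_boot all_order all_fingroup all_algebra.
From mathcomp Require Import ring.
Import GRing.Theory.
Local Open Scope ring_scope.

(* Powers y^m of linear forms span S(g) in characteristic 0, and xi(y^m) = yhat^m.
   On such a power (C^N)^i_nu acts through a matrix of ad y, and
   xi(z y^p) = 1/(p+1) sum_i yhat^i zhat yhat^(p-i) expands in powers of ad yhat;
   the defining recurrence of the Bernoulli numbers then collapses the sum to
     x_nu * f = sum_N (-1)^N B_N/N! sum_i x_i (C^N)^i_nu f.
   Commuting M_mu with this series gives, in degree N, the operator
   sum_l x_l chi^l_(N+1), where chi_(N+1) denotes the bracket of chi carrying
   C^N.  The Jacobi identity gives chi_(N+1) = Cmat chi_N for N >= 1, which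
   turns these terms into sum_t M_t chi^t_N, while N = 0 contributes the term
   sum_l C^l_(mu nu) x_l. *)

(** * Iterated polynomials: derivations and the action of differential operators *)

Section MPolyTheory.
Set Implicit Arguments.
Unset Strict Implicit.
Unset Printing Implicit Defensive.
Variable R : comNzRingType.
Implicit Types (n i : nat).

Lemma mpC0 n : mpC n (0 : R) = 0.
Proof. by elim: n => //= n ->. Qed.

Lemma mpC1 n : mpC n (1 : R) = 1.
Proof. by elim: n => //= n ->. Qed.

Lemma mpCD n : {morph @mpC R n : a b / a + b}.
Proof. by elim: n => //= n IH a b; rewrite IH polyCD. Qed.

Lemma mpCM n : {morph @mpC R n : a b / a * b}.
Proof. by elim: n => //= n IH a b; rewrite IH polyCM. Qed.

Lemma mpD0 n i : mpD i (0 : mpoly R n) = 0.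
Proof.
by elim: n => //= n IH; case: eqP => _; [exact: deriv0 | exact: map_poly0].
Qed.

Lemma mpDD n i : {morph @mpD R n i : f g / f + g}.
Proof.
elim: n => [|n IH] f g /=; first by rewrite addr0.
case: eqP => _; first exact: derivD.
by apply/polyP => j; rewrite coefD !coef_map_id0 ?mpD0 // coefD IH.
Qed.

Lemma map_poly_polyC (S T : nzSemiRingType) (g : S -> T) c :
  g 0 = 0 -> map_poly g c%:P = (g c)%:P.
Proof. by move=> g0; apply/polyP => -[|j]; rewrite coef_map_id0 // !coefC. Qed.

Lemma mpD_mpC n i (c : R) : mpD i (mpC n c) = 0.
Proof.
elim: n => //= n IH; case: eqP => _; first exact: derivC.
by rewrite map_poly_polyC ?mpD0 ?IH // polyC0.
Qed.

Lemma mpD_mpX n i j : (i < n)%N -> mpD i (mpX R n j) = (i == j)%:R.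
Proof.
elim: n => //= n IH; rewrite ltnS leq_eqVlt => /orP[/eqP-> | lt_in].
  rewrite eqxx eq_sym; case: eqP => _; first exact: derivX.
  exact: derivC.
rewrite (ltn_eqF lt_in); case: eqP => [-> | _].
  rewrite (ltn_eqF lt_in); apply/polyP => k.
  rewrite coef_map_id0 ?mpD0 // coef0 coefX.
  by case: (k == 1%N); rewrite ?mpD0 // -(mpC1 n) mpD_mpC.
by rewrite map_poly_polyC ?mpD0 // IH // polyCMn.
Qed.

Lemma mpDM n i (f g : mpoly R n) : mpD i (f * g) = mpD i f * g + f * mpD i g.
Proof.
elim: n f g => [|n IH] f g /=; first by rewrite mulr0 mul0r addr0.
case: eqP => _; first exact: derivM.
have sumD := big_morph (@mpD R n i) (@mpDD n i) (@mpD0 n i).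
apply/polyP => j; rewrite coefD coef_map_id0 ?mpD0 // !coefM sumD -big_split /=.
by apply: eq_bigr => l _; rewrite !coef_map_id0 ?mpD0 // IH.
Qed.

Lemma mpactD_r n (d : mpoly R n) : {morph mpact d : f g / f + g}.
Proof.
elim: n d => [|n IH] d f g /=; first exact: mulrDr.
have act0 e : @mpact R n e 0 = 0.
  by apply: (@addrI _ (mpact e 0)); rewrite -IH !addr0.
rewrite -big_split; apply: eq_bigr => j _ /=.
by apply/polyP => l; rewrite coefD !coef_map_id0 // derivnD coefD IH.
Qed.

Lemma mpact_r0 n (d : mpoly R n) : mpact d 0 = 0.
Proof. by apply: (@addrI _ (mpact d 0)); rewrite -mpactD_r !addr0. Qed.

Lemma mpact_0l n (f : mpoly R n) : mpact 0 f = 0.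
Proof.
case: n f => [|n] f /=; first exact: mul0r.
by rewrite size_poly0 big_ord0.
Qed.

(** Coefficients of [d] past its size act as zero, so operators of different sizes can be expanded
    over one common range. *)
Lemma mpactS n K (d f : {poly mpoly R n}) : (size d <= K)%N ->
  @mpact R n.+1 d f = \sum_(j < K) map_poly (mpact d`_j) (derivn j f).
Proof.
move=> leK /=.
rewrite (big_ord_widen K (fun j => map_poly (mpact d`_j) (derivn j f)) leK).
rewrite big_mkcond; apply: eq_bigr => j _; case: ltnP => // le_dj.
apply/polyP => l; rewrite coef_map_id0 ?mpact_r0 // (nth_default 0 le_dj).
by rewrite mpact_0l coef0.
Qed.

Lemma mpolyS_eq n (f g : {poly mpoly R n}) :
  (forall l, f`_l = g`_l) -> f = g :> mpoly R n.+1.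
Proof. by move=> eq_fg; apply/polyP. Qed.

Lemma coef_mpactS n K (d f : {poly mpoly R n}) l : (size d <= K)%N ->
  (@mpact R n.+1 d f : {poly mpoly R n})`_l = \sum_(j < K) mpact d`_j (derivn j f)`_l.
Proof.
move=> leK; rewrite (mpactS _ leK) coef_sum.
by apply: eq_bigr => j _; rewrite coef_map_id0 ?mpact_r0.
Qed.

Lemma mpactD_l n (f : mpoly R n) : {morph (fun d => mpact d f) : d e / d + e}.
Proof.
elim: n f => [|n IH] f d e; first exact: mulrDl.
pose K := maxn (size d) (maxn (size e) (size (d + e : {poly mpoly R n}))).
apply: mpolyS_eq => l.
rewrite [RHS](@coefD (mpoly R n)).
rewrite !(@coef_mpactS n K) /K ?leq_max ?leqnn ?orbT // -big_split.
by apply: eq_bigr => j _; rewrite (@coefD (mpoly R n)) IH.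
Qed.

Lemma mpact_mpCM n (c : R) (d f : mpoly R n) :
  mpact (mpC n c * d) f = mpC n c * mpact d f.
Proof.
elim: n d f => [|n IH] d f; first by rewrite /= mulrA.
apply: mpolyS_eq => l; rewrite [mpC n.+1 c]/= (@coefCM (mpoly R n)).
rewrite !(@coef_mpactS n (size d)) //; last first.
  by rewrite mul_polyC; exact: size_scale_leq.
by rewrite mulr_sumr; apply: eq_bigr => j _; rewrite (@coefCM (mpoly R n)) IH.
Qed.

Lemma mpactMn n (d f : mpoly R n) m : mpact d (f *+ m) = mpact d f *+ m.
Proof. by elim: m => [|m IH]; rewrite ?mpact_r0 // !mulrS mpactD_r IH. Qed.

(** For the outer variable, the product shifts the coefficients of [d] by one, pairing each with one
    more derivative; inner variables are handled coefficientwise by induction. *)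
Lemma mpact_mpXM n i (d f : mpoly R n) : (i < n)%N ->
  mpact (mpX R n i * d) f = mpD i (mpact d f).
Proof.
elim: n d f => // n IH d f; rewrite ltnS leq_eqVlt => /orP[/eqP-> | lt_in].
  apply: mpolyS_eq => l; rewrite [mpD _ _]/= [mpX _ _ _]/= eqxx coef_deriv.
  rewrite (@coef_mpactS n (size d) d) // (@coef_mpactS n (size d).+1); last first.
    by have := size_mul_leq 'X (d : {poly mpoly R n}); rewrite size_polyX.
  rewrite big_ord_recl /= (@coefXM (mpoly R n)) mpact_0l add0r -sumrMnl.
  apply: eq_bigr => j _; rewrite (@coefXM (mpoly R n)) /= /bump !add0n coef_deriv.
  exact: mpactMn.
apply: mpolyS_eq => l; rewrite [mpD _ _]/= [mpX _ _ _]/= !(ltn_eqF lt_in).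
rewrite coef_map_id0 ?mpD0 // !(@coef_mpactS n (size d)) //; last first.
  by rewrite mul_polyC; exact: size_scale_leq.
rewrite (big_morph (@mpD R n i) (@mpDD n i) (@mpD0 n i)).
by apply: eq_bigr => j _; rewrite (@coefCM (mpoly R n)) IH.
Qed.

Lemma mpact_1l n (f : mpoly R n) : mpact 1 f = f.
Proof.
elim: n f => [|n IH] f; first exact: mul1r.
rewrite /= size_poly1 big_ord1 coef1 /=.
by apply/polyP => l; rewrite coef_map_id0 ?mpact_r0 // IH.
Qed.

Lemma mpact_mpC n (c : R) (f : mpoly R n) : mpact (mpC n c) f = mpC n c * f.
Proof. by rewrite -[mpC n c]mulr1 mpact_mpCM mpact_1l mulr1. Qed.

Lemma mpact_mpX n i (f : mpoly R n) : (i < n)%N -> mpact (mpX R n i) f = mpD i f.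
Proof. by move=> lt_in; rewrite -[mpX R n i]mulr1 mpact_mpXM // mpact_1l. Qed.

Lemma mpoly_ring_ind n (P : mpoly R n -> Prop) :
  (forall c, P (mpC n c)) -> (forall i, (i < n)%N -> P (mpX R n i)) ->
  (forall f g, P f -> P g -> P (f + g)) -> (forall f g, P f -> P g -> P (f * g)) ->
  forall f, P f.
Proof.
elim: n P => [|n IH] P PC PX PD PM f; first exact: PC.
(* The induction hypothesis is applied to the restriction of [P] to constants in the outer
   variable. *)
have Ppoly c : P c%:P.
  apply: (IH (fun c => P c%:P)) => {c} [c | i lt_in | c d Pc Pd | c d Pc Pd].
  - exact: (PC c).
  - by have /= := PX i (ltnW lt_in); rewrite (ltn_eqF lt_in).
  - by rewrite polyCD; exact: PD.
  - by rewrite polyCM; exact: PM.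
elim/poly_ind: f => [|p c Pp]; first exact: (Ppoly 0).
by apply: PD => //; apply: PM => //; have /= := PX n (ltnSn n); rewrite eqxx.
Qed.

(** One-sided induction, suited to [mpactM]: what is known before it is how a constant or a variable
    times [d] acts. *)
Lemma mpoly_module_ind n (P : mpoly R n -> Prop) : P 1 ->
  (forall f g, P f -> P g -> P (f + g)) -> (forall c f, P f -> P (mpC n c * f)) ->
  (forall i f, (i < n)%N -> P f -> P (mpX R n i * f)) -> forall f, P f.
Proof.
(* Generalizing [1] to any [h] satisfying [P] makes the product case a composition of the two
   hypotheses. *)
move=> P1 PD PC PX f; rewrite -[f]mulr1; move: (1) P1.
elim/mpoly_ring_ind: f => [c | i lt_in | f g IHf IHg | f g IHf IHg] h Ph.
- exact: PC.
- exact: PX.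
- by rewrite mulrDl; apply: PD; auto.
- by rewrite -mulrA; auto.
Qed.

Lemma mpactM n (d e f : mpoly R n) : mpact (d * e) f = mpact d (mpact e f).
Proof.
elim/mpoly_module_ind: d e f => [|d d' IH IH'|c d IH|i d lt_in IH] e f.
- by rewrite mul1r mpact_1l.
- by rewrite mulrDl !mpactD_l IH IH'.
- by rewrite -mulrA !mpact_mpCM IH.
- by rewrite -mulrA !mpact_mpXM // IH.
Qed.

(** The Weyl algebra relation: commuting an operator past a variable differentiates its symbol. This
    is the source of the derivative term of chi. *)
Lemma mpact_Xmul n i (d f : mpoly R n) : (i < n)%N ->
  mpact d (mpX R n i * f) = mpX R n i * mpact d f + mpact (mpD i d) f.
Proof.
move=> lt_in; elim/mpoly_ring_ind: d f => [c|j lt_jn|d d' IH IH'|d d' IH IH'] f.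
- by rewrite mpD_mpC mpact_0l addr0 !mpact_mpC mulrCA.
- rewrite !mpact_mpX // mpDM mpD_mpX // mpD_mpX // addrC eq_sym.
  by case: eqP => _; rewrite ?mpact_1l ?mpact_0l ?mul1r ?mul0r.
- by rewrite mpDD !mpactD_l IH IH' mulrDr addrACA.
- by rewrite mpDM mpactD_l !mpactM IH' mpactD_r IH -addrA.
Qed.

End MPolyTheory.

(** * Monomial coefficients and the exponent bound *)

Section Coefficients.
Set Implicit Arguments.
Unset Strict Implicit.
Unset Printing Implicit Defensive.
Variable R : comNzRingType.
Implicit Types (n i : nat) (e : nat -> nat).

Lemma mcoef0 n e : mcoef (0 : mpoly R n) e = 0.
Proof. by elim: n => //= n IH; rewrite coef0. Qed.

Lemma mcoefD n e : {morph (fun f : mpoly R n => mcoef f e) : f g / f + g}.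
Proof. by elim: n => //= n IH f g; rewrite coefD IH. Qed.

Lemma mcoef_mpCM n e c (f : mpoly R n) : mcoef (mpC n c * f) e = c * mcoef f e.
Proof. by elim: n f => //= n IH f; rewrite (@coefCM (mpoly R n)) IH. Qed.

(** Makes it harmless to enlarge the box of exponents in [xi]. *)
Lemma mcoef_oversize n e i (f : mpoly R n) :
  (i < n)%N -> (msize f <= e i)%N -> mcoef f e = 0.
Proof.
elim: n f => // n IH f; rewrite ltnS leq_eqVlt /= geq_max.
case: (ltnP (e n) (size f)) => [lt_en | le_en]; last first.
  by rewrite nth_default // mcoef0.
case/orP=> [/eqP-> | lt_in]; first by rewrite leqNgt lt_en.
case/andP=> _ le_max; apply: IH => //; apply: leq_trans le_max.
exact: (leq_bigmax (Ordinal lt_en)).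
Qed.

Lemma eq_mcoef n e1 e2 (f : mpoly R n) :
  (forall i, (i < n)%N -> e1 i = e2 i) -> mcoef f e1 = mcoef f e2.
Proof.
elim: n f => //= n IH f eq_e; rewrite eq_e //.
by apply: IH => i lt_in; apply/eq_e/ltnW.
Qed.

Lemma mcoef_monomial n e1 e2 :
  mcoef (\prod_(i < n) mpX R n i ^+ e1 i) e2 =
  [forall i : 'I_n, e1 i == e2 i]%:R.
Proof.
elim: n => [|n IH].
  by rewrite big_ord0 /=; case: forallP => // -[] [].
have -> : \prod_(i < n.+1) mpX R n.+1 i ^+ e1 i =
    (\prod_(i < n) mpX R n i ^+ e1 i)%:P * 'X^(e1 n) :> {poly mpoly R n}.
  rewrite big_ord_recr /= eqxx rmorph_prod; congr (_ * _).
  by apply: eq_bigr => i _; rewrite (ltn_eqF (ltn_ord i)) rmorphXn.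
rewrite /= coefCM coefXn; case: (eqVneq (e1 n) (e2 n)) => [eq_n | neq_n].
  rewrite mulr1 IH; congr (_%:R); congr nat_of_bool.
  apply/forallP/forallP => eq_e i; last exact: (eq_e (widen_ord (leqnSn n) i)).
  have [lt_in | ] := ltnP i n; first exact: (eq_e (Ordinal lt_in)).
  move=> le_ni; suff -> : i = n :> nat by apply/eqP.
  by apply/eqP; rewrite eqn_leq le_ni -ltnS ltn_ord.
rewrite mulr0 mcoef0; case: forallP => // /(_ ord_max) /= /eqP eq_n.
by case/eqP: neq_n.
Qed.

End Coefficients.

(** * The map [xi] on words and on products of linear forms *)

Section SymmetrizedWords.
Set Implicit Arguments.
Unset Strict Implicit.
Unset Printing Implicit Defensive.
Variables (k : fieldType) (n : nat) (A : algType k) (iota : 'I_n -> A).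

Lemma expo_ofE B (e : {ffun 'I_n -> 'I_B}) (i : 'I_n) : expo_of e i = e i.
Proof.
rewrite /expo_of /image_mem (nth_map i) ?size_enum_ord //.
by rewrite nth_ord_enum.
Qed.

Lemma eq_mword (e1 e2 : 'I_n -> nat) : e1 =1 e2 -> mword e1 = mword e2.
Proof. by move=> eq_e; rewrite /mword; congr flatten; apply: eq_map => j; rewrite eq_e. Qed.

Lemma count_mword (e : 'I_n -> nat) i : count_mem i (mword e) = e i.
Proof.
rewrite /mword count_flatten -map_comp sumnE big_map big_enum /= (bigD1 i) //=.
rewrite count_nseq /= eqxx mul1n big1 ?addn0 // => j /negPf neq_ji.
by rewrite count_nseq /= neq_ji.
Qed.

Lemma symword_tuple m (t : m.-tuple 'I_n) :
  symword iota t =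
  (m`!%:R)^-1 *: \sum_(s : 'S_m) \prod_(j < m) iota (tnth t (s j)).
Proof.
case: t => w /= sz_w; have := eqP sz_w; move: sz_w => /[swap] <- sz_w.
by have -> : Tuple sz_w = in_tuple w by apply: val_inj.
Qed.

(** A reordering of the letters is absorbed by reindexing the sum over all permutations. *)
Lemma perm_symword (w1 w2 : seq 'I_n) :
  perm_eq w1 w2 -> symword iota w1 = symword iota w2.
Proof.
move=> eq_w; have /eqP sz_w := perm_size eq_w.
case/(@tuple_permP _ _ _ (in_tuple w2)): (eq_w) => p def_w1.
rewrite -[w1]/(val (Tuple sz_w)) -[w2]/(val (in_tuple w2)) !symword_tuple.
have -> : Tuple sz_w = [tuple tnth (in_tuple w2) (p i) | i < size w2].
  exact: val_inj.
congr (_ *: _); rewrite (reindex_inj (mulIg p^-1)%g) /=.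
apply: eq_bigr => s _; apply: eq_bigr => j _; rewrite tnth_mktuple.
by rewrite -permM mulgKV.
Qed.

(** The box in the definition of [xi] depends on the polynomial; a free bound puts several
    polynomials over one box, whence linearity. *)
Lemma xi_widen (f : mpoly k n) b : (msize f <= b)%N ->
  xi iota f = \sum_(e : {ffun 'I_n -> 'I_b})
    mcoef f (expo_of e) *: symword iota (mword (fun j => nat_of_ord (e j))).
Proof.
move=> le_b; pose h (e : {ffun 'I_n -> 'I_(msize f)}) : {ffun 'I_n -> 'I_b} :=
  [ffun i => widen_ord le_b (e i)].
have h_inj : injective h.
  move=> e1 e2 /ffunP eq_h; apply/ffunP=> i; apply/val_inj.
  by have := congr1 val (eq_h i); rewrite !ffunE.
rewrite [RHS](bigID (mem (h @: setT))) /= [X in _ + X]big1 => [|e not_he].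
  rewrite addr0 big_imset /=; last by move=> ? ? _ _; exact: h_inj.
  rewrite /xi; apply: eq_big => e; first by rewrite inE.
  move=> _; congr (_ *: symword iota _).
    apply: eq_mcoef => i lt_in.
    by rewrite !(expo_ofE _ (Ordinal lt_in)) ffunE.
  by apply: eq_mword => i; rewrite ffunE.
(* A vector outside the image of [h] has an entry at least [msize f], and its coefficient
   vanishes. *)
have [i le_i | lt_e] := pickP [pred i : 'I_n | (msize f <= e i)%N].
  by rewrite (@mcoef_oversize _ _ _ i) ?scale0r // expo_ofE.
have lt_e' i : (e i < msize f)%N by rewrite ltnNge; apply/negbT/lt_e.
case/imsetP: not_he; exists [ffun i => Ordinal (lt_e' i)] => //.
by apply/ffunP=> i; rewrite !ffunE; apply: val_inj.
Qed.

Lemma xiD : {morph xi iota : f g / f + g}.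
Proof.
move=> f g; pose b := maxn (msize (f + g)) (maxn (msize f) (msize g)).
rewrite !(@xi_widen _ b) /b ?leq_max ?leqnn ?orbT // -big_split.
by apply: eq_bigr => e _; rewrite mcoefD scalerDl.
Qed.

Lemma xiZ c f : xi iota (mpC n c * f) = c *: xi iota f.
Proof.
pose b := maxn (msize (mpC n c * f)) (msize f).
rewrite !(@xi_widen _ b) /b ?leq_max ?leqnn ?orbT // scaler_sumr.
by apply: eq_bigr => e _; rewrite mcoef_mpCM scalerA.
Qed.

Lemma xi0 : xi iota 0 = 0.
Proof. by rewrite -[0](mul0r 0) -(mpC0 k n) xiZ scale0r. Qed.

Lemma xi_monomial (e : nat -> nat) :
  xi iota (\prod_(i < n) mpX k n i ^+ e i) = symword iota (mword (fun j : 'I_n => e j)).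
Proof.
set f := \prod_(i < n) _.
pose b := maxn (msize f) (\max_(i < n) e i).
rewrite (@xi_widen _ b.+1); last by rewrite leqW // leq_maxl.
have lt_b (i : 'I_n) : (e i < b.+1)%N.
  by rewrite ltnS leq_max (leq_bigmax i) orbT.
rewrite (bigD1 [ffun i => Ordinal (lt_b i)]) //= big1 ?addr0 => [|e' neq_e].
  rewrite mcoef_monomial (_ : [forall i, _]) ?scale1r.
    by congr (symword iota _); apply: eq_mword => i; rewrite ffunE.
  by apply/forallP=> i; rewrite expo_ofE ffunE.
rewrite mcoef_monomial; case: forallP => [eq_e|_]; last by rewrite scale0r.
case/eqP: neq_e; apply/ffunP=> i; apply/val_inj; rewrite ffunE /=.
by have /eqP := eq_e i; rewrite expo_ofE.
Qed.

Lemma xi_word m (t : m.-tuple 'I_n) :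
  xi iota (\prod_(j < m) var k (tnth t j)) = symword iota t.
Proof.
pose e i := count_mem i [seq nat_of_ord x | x <- t].
have eE (i : 'I_n) : e i = count_mem i t.
  by rewrite /e count_map; apply: eq_count => x /=; rewrite -val_eqE.
have -> : \prod_(j < m) var k (tnth t j) = \prod_(i < n) mpX k n i ^+ e i.
  (* The factors are grouped by letter; the exponent of [i] is its multiplicity in [t]. *)
  transitivity (\prod_(x <- t) \prod_(i < n | x == i) var k i).
    rewrite big_tuple; apply: eq_bigr => j _.
    by rewrite (eq_bigl (pred1 (tnth t j))) ?big_pred1_eq // => i; rewrite /= eq_sym.
  rewrite (exchange_big_dep predT) //=; apply: eq_bigr => i _.
  by rewrite eE big_const_seq iter_mulr_1.
rewrite xi_monomial; apply/perm_symword/allP => i _ /=.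
by rewrite count_mword eE.
Qed.

Definition linform (a : 'I_n -> k) : mpoly k n := \sum_i sc n (a i) * var k i.
Definition linform_in (a : 'I_n -> k) : A := \sum_i a i *: iota i.

(** Expanding both sides multilinearly reduces the claim to words, where it is [xi_word]. *)
Lemma xi_prod_linform m (a : 'I_m -> 'I_n -> k) :
  xi iota (\prod_(j < m) linform (a j)) =
  (m`!%:R)^-1 *: \sum_(s : 'S_m) \prod_(j < m) linform_in (a (s j)).
Proof.
rewrite /linform bigA_distr_bigA /= (big_morph _ xiD xi0).
transitivity (\sum_(g : {ffun 'I_m -> 'I_n}) (\prod_j a j (g j)) *:
  ((m`!%:R)^-1 *: \sum_(s : 'S_m) \prod_(j < m) iota (g (s j)))).
  apply: eq_bigr => g _; rewrite big_split /=.
  rewrite -(big_morph _ (@mpCM k n) (@mpC1 k n)) xiZ.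
  have -> : \prod_(j < m) var k (g j) = \prod_(j < m) var k (tnth [tuple g j | j < m] j).
    by apply: eq_bigr => j _; rewrite tnth_mktuple.
  rewrite xi_word symword_tuple; congr (_ *: (_ *: _)).
  by apply: eq_bigr => s _; apply: eq_bigr => j _; rewrite tnth_mktuple.
under eq_bigr do rewrite scalerA mulrC -scalerA scaler_sumr.
rewrite -scaler_sumr exchange_big /=; congr (_ *: _).
apply: eq_bigr => s _; rewrite /linform_in bigA_distr_bigA /=.
(* Place [j] of the product carries the form of index [s j], so choice functions are transported
   along [s]. *)
rewrite (reindex (fun h : {ffun 'I_m -> 'I_n} => [ffun j => h (s^-1%g j)])) /=; last first.
  exists (fun h : {ffun 'I_m -> 'I_n} => [ffun j => h (s j)]) => h _;
    by apply/ffunP=> j; rewrite !ffunE ?permK ?permKV.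
apply: eq_bigr => h _; rewrite scaler_prod; congr (_ *: _).
  rewrite (reindex_inj (@perm_inj _ s)); apply: eq_bigr => j _.
  by rewrite ffunE permK.
by apply: eq_bigr => j _; rewrite ffunE permK.
Qed.

End SymmetrizedWords.

(** * Polarization: powers of linear forms span in characteristic 0 *)

Section Polarization.
Set Implicit Arguments.
Unset Strict Implicit.
Unset Printing Implicit Defensive.

(* The alternating sum over S containing the image of g : 'I_m -> 'I_m vanishes
   unless g is onto, i.e. a permutation. *)
Lemma polarization (R : comNzRingType) m (a : 'I_m -> R) :
  \sum_(S : {set 'I_m}) (-1) ^+ #|~: S| * (\sum_(i in S) a i) ^+ m =
  (m`!)%:R * \prod_i a i.
Proof.
have powE (y : R) : y ^+ m = \prod_(j < m) y by rewrite prodr_const card_ord.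
(* Inclusion-exclusion: expanding the product over [i] gives the signed sum over the sets [S] that
   contain the image of [g]. *)
transitivity (\sum_(g : {ffun 'I_m -> 'I_m})
    (\prod_j a (g j)) * \prod_i (1 - (i \notin codom g)%:R)).
  under eq_bigr => S _.
    rewrite powE (bigA_distr_big _ (fun=> a)) big_mkcond mulr_sumr; over.
  rewrite exchange_big; apply: eq_bigr => g _ /=.
  rewrite [X in _ * X]bigA_distr mulr_sumr; apply: eq_bigr => S _.
  rewrite [X in _ = _ * X](bigID (mem S)) /=.
  rewrite [X in _ = _ * (X * _)]big1 ?mul1r => [|i -> //].
  case: (boolP (g \in ffun_on (mem S))) => [/ffun_onP gS | gS'].
    rewrite mulrC; congr (_ * _).
    rewrite -prodr_const; apply: eq_big => i; rewrite ?inE // => /negPf Si.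
    rewrite Si; case: codomP => [[j eq_i]|_] //.
    by rewrite eq_i gS in Si.
  have [j gj'] : exists j, g j \notin S.
    by apply/existsP; apply: contraNT gS' => /existsPn gS; apply/ffun_onP=> j; exact/negPn/gS.
  rewrite mulr0 [X in _ = _ * X](bigD1 (g j)) //= (negPf gj') codom_f oppr0.
  by rewrite mul0r mulr0.
rewrite (bigID (fun g : {ffun 'I_m -> 'I_m} => injectiveb g)) /=.
rewrite [X in _ + X]big1 ?addr0 => [|g g_ninj].
  transitivity (\sum_(g : {ffun 'I_m -> 'I_m} | injectiveb g) \prod_i a i).
    apply: eq_bigr => g /injectiveP g_inj.
    rewrite [X in _ * X]big1 ?mulr1 => [|i _].
      by rewrite [RHS](reindex_inj g_inj).
    by rewrite injF_onto // subr0.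
  rewrite sumr_const mulr_natl; congr (_ *+ _).
  by have := card_inj_ffuns 'I_m 'I_m; rewrite card_ord ffactnn cardsE.
have [i i_out] : exists i, i \notin codom g.
  apply/existsP; apply: contraNT g_ninj => /existsPn g_onto.
  apply/card_uniqP; rewrite size_map -cardE; apply: eq_card => i.
  by rewrite inE; apply/negbNE/g_onto.
by rewrite [X in _ * X](bigD1 i) //= i_out subrr mul0r mulr0.
Qed.

Lemma mpoly_word_ind (R : comNzRingType) n (P : mpoly R n -> Prop) :
  (forall f g, P f -> P g -> P (f + g)) -> (forall c f, P f -> P (mpC n c * f)) ->
  (forall m (t : 'I_m -> 'I_n), P (\prod_(j < m) mpX R n (t j))) -> forall f, P f.
Proof.
move=> PD PC PW f.
(* The statement is strengthened so that the induction can move the letters of [f] into a growing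
   word; the empty word recovers the claim. *)
suff: forall m (t : 'I_m -> 'I_n), P (f * \prod_(j < m) mpX R n (t j)).
  by move/(_ 0%N (fun j => False_rect _ (notF (valP j)))); rewrite big_ord0 mulr1.
elim/mpoly_module_ind: f => [|f g IHf IHg|c f IH|i f lt_in IH] m t.
- by rewrite mul1r.
- by rewrite mulrDl; apply: PD.
- by rewrite -mulrA; apply: PC.
- pose t' (j : 'I_m.+1) := if unlift ord0 j is Some j' then t j' else Ordinal lt_in.
  have := IH _ t'; rewrite big_ord_recl /t' unlift_none /= mulrCA mulrA.
  by under eq_bigr do rewrite liftK.
Qed.

(** By [polarization], [m!] times a word of length [m] is a signed sum of [m]-th powers of linear
    forms, and [m!] is invertible. *)
Lemma mpoly_power_ind (k : fieldType) n (P : mpoly k n -> Prop) :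
  [pchar k] =i pred0 ->
  (forall f g, P f -> P g -> P (f + g)) -> (forall c f, P f -> P (mpC n c * f)) ->
  (forall a m, P (linform a ^+ m)) -> forall f, P f.
Proof.
move=> /pcharf0P char0 PD PC PX; apply: mpoly_word_ind => // m t.
have mpC_nat r : mpC n r%:R = r%:R :> mpoly k n.
  by elim: r => [|r IH]; rewrite ?mpC0 // !mulrS mpCD IH mpC1.
have -> : \prod_(j < m) mpX k n (t j) =
    mpC n (m`!%:R)^-1 * (m`!%:R * \prod_(j < m) mpX k n (t j)).
  by rewrite mulrA -mpC_nat -mpCM mulVf ?mpC1 ?mul1r // char0 -lt0n fact_gt0.
apply: (PC); rewrite -polarization; apply: big_ind => // [|S _].
  (* [P 0], required for the empty sum, is obtained as zero times a power. *)
  by rewrite -(mul0r 1) -(mpC0 k n); apply: PC; exact: (PX (fun=> 0) 0%N).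
have -> : (-1) ^+ #|~: S| = mpC n ((-1) ^+ #|~: S|) :> mpoly k n.
  elim: #|_| => [|r IH]; rewrite ?mpC1 // !exprS mpCM -IH; congr (_ * _).
  by apply: (@addIr _ 1); rewrite -(mpC1 k n) -mpCD !addNr mpC0.
have -> : \sum_(j in S) mpX k n (t j) =
    linform (fun i => \sum_(j in S | t j == i) 1).
  rewrite /linform (partition_big t predT) //=; apply: eq_bigr => i _.
  rewrite /sc (big_morph _ (@mpCD k n) (@mpC0 k n)) mulr_suml.
  by apply: eq_bigr => j /andP[_ /eqP <-]; rewrite mpC1 mul1r.
by apply: PC; apply: PX.
Qed.

End Polarization.

(** * Insertions into a power of [y], expanded in powers of [ad y] *)

Section AdjointExpansion.
Set Implicit Arguments.
Unset Strict Implicit.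
Unset Printing Implicit Defensive.

Definition adl (A : nzRingType) (y w : A) := y * w - w * y.

(* (L^(p+1) - R^(p+1)) / (L - R) expanded at L = R + ad y, where L and R are the
   left and right multiplications by y. *)
Lemma sum_pow_mul_pow (A : nzRingType) (y w : A) p :
  \sum_(i < p.+1) y ^+ i * w * y ^+ (p - i) =
  \sum_(j < p.+1) (iter j (adl y) w * y ^+ (p - j)) *+ 'C(p.+1, j.+1).
Proof.
elim: p => [|p IH]; first by rewrite !big_ord1 /= expr0 mul1r.
pose W j := iter j (adl y) w.
have yW j q : y * (W j * y ^+ q) = W j.+1 * y ^+ q + W j * y ^+ q.+1.
  by rewrite /W /= {2}/adl mulrBl exprS !mulrA subrK.
rewrite big_ord_recl /= expr0 mul1r subn0.
have -> : \sum_(i < p.+1) y ^+ lift ord0 i * w * y ^+ (p.+1 - lift ord0 i) =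
    y * \sum_(i < p.+1) y ^+ i * w * y ^+ (p - i).
  rewrite mulr_sumr; apply: eq_bigr => i _.
  by rewrite lift0 exprS subSS !mulrA.
pose T j := W j * y ^+ (p.+1 - j).
have -> : y * \sum_(i < p.+1) y ^+ i * w * y ^+ (p - i) =
    \sum_(j < p.+1) T j.+1 *+ 'C(p.+1, j.+1) + \sum_(j < p.+1) T j *+ 'C(p.+1, j.+1).
  rewrite IH mulr_sumr -big_split; apply: eq_bigr => j _ /=.
  by rewrite mulrnAr yW -subSn ?leq_ord // mulrnDl /T subSS.
(* The added top term has a vanishing binomial coefficient; the two sums then share a range and
   merge by Pascal's rule. *)
have -> : \sum_(j < p.+1) T j *+ 'C(p.+1, j.+1) = \sum_(j < p.+2) T j *+ 'C(p.+1, j.+1).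
  by rewrite [RHS]big_ord_recr /= bin_small // mulr0n addr0.
have -> : w * y ^+ p.+1 + (\sum_(j < p.+1) T j.+1 *+ 'C(p.+1, j.+1) +
      \sum_(j < p.+2) T j *+ 'C(p.+1, j.+1)) =
    \sum_(j < p.+2) T j *+ 'C(p.+1, j) + \sum_(j < p.+2) T j *+ 'C(p.+1, j.+1).
  by rewrite addrA [in RHS]big_ord_recl.
by rewrite addrC -big_split; apply: eq_bigr => j _ /=; rewrite -mulrnDr -binS.
Qed.

Lemma prod_insert (A : nzRingType) (y z : A) p (i : 'I_p.+1) :
  \prod_(j < p.+1) (if j == i then z else y) = y ^+ i * z * y ^+ (p - i).
Proof.
rewrite -(big_mkord xpredT (fun j => if j == i :> nat then z else y)).
have le_ip : (i <= p)%N by rewrite -ltnS.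
rewrite (big_cat_nat (n := i)) //=; last by rewrite ltnW // ltnS.
rewrite [X in _ * X]big_ltn ?ltnS //= eqxx mulrA; congr (_ * _ * _).
  rewrite (eq_big_nat _ _ (F2 := fun=> y)) => [|j /andP[_ lt_ji]].
    by rewrite prodr_const_nat subn0.
  by rewrite (ltn_eqF lt_ji).
rewrite (eq_big_nat _ _ (F2 := fun=> y)) => [|j /andP[lt_ij _]].
  by rewrite prodr_const_nat subSS.
by rewrite (gtn_eqF lt_ij).
Qed.

(* Stated without dividing: each value is taken by p! of the (p+1)! permutations. *)
Lemma sum_perm_at (V : zmodType) p (G : 'I_p.+1 -> V) :
  (\sum_(s : 'S_p.+1) G (s ord0)) *+ p.+1 = (\sum_i G i) *+ (p.+1)`!.
Proof.
transitivity (\sum_(j < p.+1) \sum_(s : 'S_p.+1) G (s j)).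
  have <- : \sum_(j < p.+1) \sum_(s : 'S_p.+1) G (s ord0) =
      (\sum_(s : 'S_p.+1) G (s ord0)) *+ p.+1 by rewrite sumr_const card_ord.
  apply: eq_bigr => j _.
  rewrite (reindex_inj (mulgI (tperm ord0 j))%g) /=.
  by apply: eq_bigr => s _; rewrite permM tpermL.
rewrite exchange_big -(card_Sn p.+1) -sumr_const; apply: eq_bigr => s _.
by rewrite [RHS](reindex_inj (@perm_inj _ s)).
Qed.

End AdjointExpansion.

(** * Symmetrization of a power, and of a linear form times a power *)

Section SymmetrizedPowers.
Set Implicit Arguments.
Unset Strict Implicit.
Unset Printing Implicit Defensive.
Variables (k : fieldType) (n : nat) (A : algType k) (iota : 'I_n -> A).
Hypothesis char0 : [pchar k] =i pred0.

Lemma natr_neq0 m : (0 < m)%N -> m%:R != 0 :> k.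
Proof. by move/pcharf0P: char0 => ->; rewrite lt0n. Qed.

Lemma factr_neq0 m : m`!%:R != 0 :> k.
Proof. exact/natr_neq0/fact_gt0. Qed.

Lemma xi_linform_pow a m : xi iota (linform a ^+ m) = linform_in iota a ^+ m.
Proof.
rewrite -[m in LHS](card_ord m) -prodr_const (xi_prod_linform iota (fun=> a)).
rewrite prodr_const card_ord sumr_const card_Sn -scaler_nat scalerA.
by rewrite mulVf ?scale1r // factr_neq0.
Qed.

(** An ordering of one [z] and [p] copies of [a] depends only on the place of [z], and permutations
    distribute that place evenly. *)
Lemma xi_linform_mul_pow z a p (y := linform_in iota a) :
  xi iota (linform z * linform a ^+ p) =
  p.+1%:R^-1 *: \sum_(i < p.+1) y ^+ i * linform_in iota z * y ^+ (p - i).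
Proof.
pose b (j : 'I_p.+1) := if j == ord0 then z else a.
have -> : linform z * linform a ^+ p = \prod_(j < p.+1) linform (b j).
  by rewrite big_ord_recl /b /= prodr_const card_ord.
pose G (i : 'I_p.+1) := y ^+ i * linform_in iota z * y ^+ (p - i).
rewrite xi_prod_linform -[X in _ = _ *: X]/(\sum_i G i).
transitivity ((p.+1)`!%:R^-1 *: \sum_(s : 'S_p.+1) G (s ord0)).
  (* After passing to inverses, [s] puts [z] at place [s ord0]. *)
  congr (_ *: _); rewrite (reindex_inj invg_inj) /=; apply: eq_bigr => s _.
  rewrite /G -prod_insert; apply: eq_bigr => j _.
  by rewrite /b (canF_eq (permKV s)); case: ifP.
(* This nonzero factor clears both denominators, giving the form of [sum_perm_at]. *)
apply: (scalerI (a := p.+1%:R * (p.+1)`!%:R)).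
  by rewrite mulf_neq0 ?factr_neq0 ?natr_neq0.
rewrite scalerA mulfK ?factr_neq0 // mulrC scalerA mulfK ?natr_neq0 //.
by rewrite !scaler_nat sum_perm_at.
Qed.

End SymmetrizedPowers.

(** * Left star multiplication by a generator as a Bernoulli series *)

Section LeftMultiplication.
Set Implicit Arguments.
Unset Strict Implicit.
Unset Printing Implicit Defensive.
Variables (k : fieldType) (n : nat) (C : 'I_n -> 'I_n -> 'I_n -> k).
Variables (B : nat -> k) (A : algType k) (iota : 'I_n -> A).

Lemma pd_linform_pow i (a : 'I_n -> k) m :
  pd i (linform a ^+ m) = sc n (m%:R * a i) * linform a ^+ m.-1.
Proof.
have pd_lin : pd i (linform a) = sc n (a i).
  rewrite /pd /linform (big_morph _ (@mpDD k n i) (@mpD0 k n i)) (bigD1 i) //=.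
  rewrite big1 => [|j neq_ji]; rewrite /sc /var mpDM mpD_mpC mul0r add0r mpD_mpX //.
    by rewrite eqxx mulr1 addr0.
  by rewrite -val_eqE eq_sym in neq_ji; rewrite (negPf neq_ji) mulr0.
elim: m => [|m IH]; first by rewrite expr0 mul0r /pd -(mpC1 k n) mpD_mpC /sc mpC0 mul0r.
rewrite exprS /pd mpDM -!/(pd i _) pd_lin IH /sc mulrS mulrDl mul1r mpCD mulrDl.
congr (_ + _); case: m {IH} => [|m /=]; first by rewrite mul0r mpC0 !mul0r mulr0.
by rewrite mulrCA -exprS.
Qed.

(** [Cmat] with each derivative replaced by the number [a r]. Column [j] holds the coordinates of
    the bracket of generator [j] with [y], so this represents minus [ad y]. *)
Definition ad_mx (a : 'I_n -> k) : 'M[k]_n :=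
  \matrix_(i < n, j < n) \sum_(r < n) C i j r * a r.

(** Each derivative lowers the exponent by one and yields a coordinate of [a]; the exponents build
    the falling factorial. For [N > m] it is zero, so the truncated [m - N] does no harm. *)
Lemma mpact_Cmat_pow N i j (a : 'I_n -> k) m :
  mpact ((Cmat C ^+ N) i j) (linform a ^+ m) =
  sc n ((m ^_ N)%:R * (ad_mx a ^+ N) i j) * linform a ^+ (m - N).
Proof.
elim: N i => [|N IH] i.
  rewrite !expr0 !mxE ffactn0 mul1r subn0.
  by case: eqP => _; rewrite /sc ?mpC1 ?mpC0 ?mpact_1l ?mpact_0l ?mul1r ?mul0r.
rewrite /sc !exprS !mxE (big_morph (fun d => mpact d _) (@mpactD_l k n _) (@mpact_0l k n _)).
rewrite mulr_sumr (big_morph _ (@mpCD k n) (@mpC0 k n)) mulr_suml.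
apply: eq_bigr => l _; rewrite mpactM IH /sc !mxE.
rewrite (big_morph (fun d => mpact d _) (@mpactD_l k n _) (@mpact_0l k n _)).
rewrite mulr_suml mulr_sumr (big_morph _ (@mpCD k n) (@mpC0 k n)) mulr_suml.
apply: eq_bigr => r _; rewrite /sc mpact_mpCM /var mpact_mpX // mpDM mpD_mpC mul0r add0r.
rewrite -/(pd r _) pd_linform_pow /sc !mulrA -!mpCM -subnS; congr (mpC n _ * _).
by rewrite ffactnSr natrM; ring.
Qed.

(** For Bernoulli [B], the coefficient of [t^N] in [t / (1 - e^(-t))]. *)
Definition left_coef N : k := (-1) ^+ N * B N / (N`!)%:R.

(** The cut-off [K] replaces a power series of operators by a finite sum; a given [f] is annihilated
    by all terms of large degree. *)
Definition left_mul (nu : 'I_n) (K : nat) (f : mpoly k n) : mpoly k n :=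
  \sum_(N < K) sc n (left_coef N) *
    \sum_(i < n) var k i * mpact ((Cmat C ^+ N) i nu) f.

Lemma left_mulD nu K : {morph left_mul nu K : f g / f + g}.
Proof.
move=> f g; rewrite -big_split; apply: eq_bigr => N _ /=.
rewrite -mulrDr -big_split; congr (_ * _); apply: eq_bigr => i _ /=.
by rewrite mpactD_r mulrDr.
Qed.

Lemma mpact_scr n' (c : k) (d f : mpoly k n') :
  mpact d (mpC n' c * f) = mpC n' c * mpact d f.
Proof. by rewrite -!mpact_mpC -!mpactM mulrC. Qed.

Lemma left_mulZ nu K c f : left_mul nu K (mpC n c * f) = mpC n c * left_mul nu K f.
Proof.
rewrite mulr_sumr; apply: eq_bigr => N _; rewrite mulrCA; congr (_ * _).
by rewrite mulr_sumr; apply: eq_bigr => i _; rewrite mpact_scr mulrCA.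
Qed.

Lemma left_mul_pow nu K a m :
  left_mul nu K (linform a ^+ m) =
  \sum_(N < K) sc n (left_coef N * (m ^_ N)%:R) *
    (linform (fun i => (ad_mx a ^+ N) i nu) * linform a ^+ (m - N)).
Proof.
apply: eq_bigr => N _; rewrite /sc [in RHS]mpCM -mulrA; congr (_ * _).
rewrite {2}/linform mulr_suml mulr_sumr; apply: eq_bigr => i _.
by rewrite mpact_Cmat_pow /sc mpCM; ring.
Qed.

Hypothesis char0 : [pchar k] =i pred0.
Hypothesis HB : is_bernoulli B.
Hypothesis Hlie :
  forall i j, iota i * iota j - iota j * iota i = \sum_(l < n) C l i j *: iota l.

(** The sign appears because [ad_mx] represents minus [ad y]; it cancels the sign in [left_coef]. *)
Lemma linform_in_ad_mx nu N a :
  linform_in iota (fun i => (ad_mx a ^+ N) i nu) =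
  (-1) ^+ N *: iter N (adl (linform_in iota a)) (iota nu).
Proof.
elim: N => [|N IH].
  rewrite !expr0 scale1r /linform_in (bigD1 nu) //= !mxE eqxx scale1r big1 ?addr0 //.
  by move=> i /negPf neq_i; rewrite !mxE neq_i scale0r.
have adlZ c w : adl (linform_in iota a) (c *: w) = c *: adl (linform_in iota a) w.
  by rewrite /adl -scalerAr -scalerAl -scalerBr.
rewrite iterS [(-1) ^+ N.+1]exprS -scalerA -adlZ -IH scaleN1r /adl opprB.
rewrite /linform_in mulr_suml mulr_sumr -sumrB.
transitivity (\sum_(l < n) \sum_(r < n) ((ad_mx a ^+ N) l nu * a r) *:
    \sum_(i < n) C i l r *: iota i).
  under [RHS]eq_bigr => l _.
    under eq_bigr => r _ do rewrite scaler_sumr.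
    rewrite exchange_big; over.
  rewrite [RHS]exchange_big; apply: eq_bigr => i _ /=.
  rewrite exprS mxE scaler_suml; apply: eq_bigr => l _.
  rewrite mxE mulr_suml scaler_suml; apply: eq_bigr => r _.
  by rewrite scalerA; congr (_ *: _); ring.
apply: eq_bigr => l _; rewrite mulr_sumr mulr_suml -sumrB; apply: eq_bigr => r _.
by rewrite -Hlie -!scalerAl -!scalerAr scalerBr !scalerA [a r * _]mulrC.
Qed.

(** Collecting the expansion by the total power [M] of [ad y], the inner sum over [N] is the
    Bernoulli recurrence, so only [M = 0] survives. *)
Lemma xi_left_mul_pow nu K a m : (m < K)%N ->
  xi iota (left_mul nu K (linform a ^+ m)) = iota nu * xi iota (linform a ^+ m).
Proof.
move=> lt_mK; have fact0 := factr_neq0 char0.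
rewrite left_mul_pow (big_morph _ (xiD iota) (xi0 iota)) xi_linform_pow //.
set y := linform_in iota a.
(* The part of term [N] in [(ad y)^M]: the falling factorial, [1/(m-N+1)] and the binomial
   coefficient merge into these factorials. *)
pose F N M := (m`!%:R / (m - M)`!%:R * (B N / (N`!%:R * (M - N).+1`!%:R))) *:
  (iter M (adl y) (iota nu) * y ^+ (m - M)).
transitivity (\sum_(N < m.+1) \sum_(M < m.+1 | (N <= M)%N) F N M).
  rewrite [RHS](big_ord_widen_cond K xpredT (fun N => \sum_(M < m.+1 | (N <= M)%N) F N M)) //.
  rewrite [RHS]big_mkcond; apply: eq_bigr => N _ /=.
  rewrite /sc xiZ; case: ltnP => [le_Nm | lt_mN]; last first.
    by rewrite ffact_small // mulr0 scale0r.
  rewrite ltnS in le_Nm; rewrite xi_linform_mul_pow // linform_in_ad_mx -/y.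
  have -> : \sum_(M < m.+1 | (N <= M)%N) F N M = \sum_(i < (m - N).+1) F N (i + N)%N.
    rewrite -(big_mkord (fun M => (N <= M)%N)) -(big_mkord xpredT (fun i => F N (i + N)%N)).
    rewrite (big_cat_nat (n := N)) ?leqW //= [X in X + _]big_nat_cond.
    rewrite [X in X + _]big1 => [|M]; last by case: leqP => //; rewrite andbF.
    by rewrite add0r -{1}[nat_of_ord N]add0n big_addn subSn //; apply: eq_bigl => i; rewrite leq_addl.
  rewrite sum_pow_mul_pow scalerA scaler_sumr; apply: eq_bigr => j _.
  have -> c w i : iter i (adl y) (c *: w) = c *: iter i (adl y) w.
    elim: i => //= i ->.
    by rewrite /adl -scalerAr -scalerAl -scalerBr.
  rewrite /F -iterD -scalerAl -scaler_nat !scalerA addnK (addnC j N) subnDA; congr (_ *: _).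
  have le_jq : (j.+1 <= (m - N).+1)%N by exact: ltn_ord.
  have Dm : m`!%:R = (m ^_ N)%:R * (m - N)`!%:R :> k by rewrite -natrM ffact_fact.
  have Dq : 'C((m - N).+1, j.+1)%:R =
      (m - N).+1%:R * (m - N)`!%:R / ((j.+1)`!%:R * (m - N - j)`!%:R) :> k.
    apply: (canRL (mulfK _)); first by rewrite mulf_neq0.
    by rewrite -!natrM -factS -(bin_fact le_jq) subSS.
  rewrite Dm Dq /left_coef -[RHS]mul1r.
  (* Inserting the squared sign on the right matches the two signs on the left, so that [field] can
     treat them as an atom. *)
  have -> z : 1 * z = ((-1) ^+ N) ^+ 2 * z :> k by rewrite sqrr_sign.
  by field; rewrite !fact0 -mulrS natr_neq0.
rewrite (exchange_big_dep xpredT) //= big_ord_recl [X in _ + X]big1 => [|M _].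
  rewrite (eq_bigl (pred1 ord0)) => [|N]; last by rewrite leqn0.
  rewrite big_pred1_eq /F subn0 /= divff // mul1r subn0.
  have := HB 0%N; rewrite big_ord1 subn0 /= => ->.
  by rewrite scale1r addr0.
transitivity (\sum_(N < (lift ord0 M).+1) F N (lift ord0 M)).
  by rewrite (big_ord_widen m.+1 (fun N => F N (lift ord0 M))) //; apply: eq_bigl => N; rewrite ltnS.
by rewrite -scaler_suml -mulr_sumr HB lift0 mulr0 scale0r.
Qed.

(** Both sides are linear in [f], so powers of linear forms suffice; the bounds combine by
    maximum. *)
Lemma xi_left_mul nu f : exists K0, forall K, (K0 <= K)%N ->
  xi iota (left_mul nu K f) = iota nu * xi iota f.
Proof.
move: f; apply: (mpoly_power_ind char0) => [f g [Kf IHf] [Kg IHg]|c f [Kf IHf]|a m].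
- exists (maxn Kf Kg) => K; rewrite geq_max => /andP[le_f le_g].
  by rewrite left_mulD !xiD IHf // IHg // mulrDr.
- by exists Kf => K le_f; rewrite left_mulZ !xiZ IHf // scalerAr.
- by exists m.+1 => K; exact: xi_left_mul_pow.
Qed.

End LeftMultiplication.

(** * The commutator of [Mop] with the series, and the recurrence for chi *)

Section Commutator.
Set Implicit Arguments.
Unset Strict Implicit.
Unset Printing Implicit Defensive.
Variables (k : fieldType) (n : nat) (C : 'I_n -> 'I_n -> 'I_n -> k).

Lemma mpact_suml m (I : finType) (d : I -> mpoly k m) f :
  mpact (\sum_i d i) f = \sum_i mpact (d i) f.
Proof. exact: (big_morph (fun d => mpact d f) (@mpactD_l k m f) (@mpact_0l k m f)). Qed.

Lemma mpact_sumr m (I : finType) (d : mpoly k m) (f : I -> mpoly k m) :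
  mpact d (\sum_i f i) = \sum_i mpact d (f i).
Proof. exact: (big_morph (mpact d) (@mpactD_r k m d) (@mpact_r0 k m d)). Qed.

Lemma mpactN_l m (d f : mpoly k m) : mpact (- d) f = - mpact d f.
Proof. by apply: (@addIr _ (mpact d f)); rewrite -mpactD_l !addNr mpact_0l. Qed.

Lemma pd_sum i (I : finType) (f : I -> mpoly k n) :
  pd i (\sum_j f j) = \sum_j pd i (f j).
Proof. exact: (big_morph (mpD i) (@mpDD k n i) (@mpD0 k n i)). Qed.

Lemma mpact_varM i (d f : mpoly k n) :
  mpact d (var k i * f) = var k i * mpact d f + mpact (pd i d) f.
Proof. exact: mpact_Xmul. Qed.

Lemma MopE t f : Mop C t f = \sum_l var k l * mpact (Cmat C l t) f.
Proof.
apply: eq_bigr => l _; rewrite mxE mpact_suml mulr_sumr; apply: eq_bigr => r _.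
by rewrite /sc mpact_mpCM mpact_mpX // -mulrA mulrCA.
Qed.

Lemma pd_Cmat i l t : pd i (Cmat C l t) = sc n (C l t i).
Proof.
rewrite mxE pd_sum (bigD1 i) //= big1 => [|j neq_ji];
  rewrite /pd mpDM mpD_mpC mul0r add0r mpD_mpX //.
  by rewrite eqxx mulr1 addr0.
by rewrite -val_eqE eq_sym in neq_ji; rewrite (negPf neq_ji) mulr0.
Qed.

Lemma Mop_sum t (I : finType) (f : I -> mpoly k n) :
  Mop C t (\sum_j f j) = \sum_j Mop C t (f j).
Proof.
under [RHS]eq_bigr => j _ do rewrite MopE.
rewrite exchange_big MopE; apply: eq_bigr => l _ /=.
by rewrite mpact_sumr mulr_sumr.
Qed.

Lemma MopZ t c f : Mop C t (sc n c * f) = sc n c * Mop C t f.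
Proof.
by rewrite !MopE mulr_sumr; apply: eq_bigr => l _; rewrite mpact_scr mulrCA.
Qed.

(** Moving [Mop C mu] past [x_i] produces the structure-constant part of chi; moving the entry of
    [Cmat C ^+ N] past the variables inside [Mop C mu] produces the derivative part. *)
Lemma Mop_commutator (B : nat -> k) mu nu K f :
  Mop C mu (left_mul C B nu K f) - left_mul C B nu K (Mop C mu f) =
  \sum_(N < K) sc n (left_coef B N) *
    \sum_(l < n) var k l * mpact (chi_term C N.+1 l mu nu) f.
Proof.
rewrite /left_mul Mop_sum -sumrB; apply: eq_bigr => N _.
rewrite MopZ -mulrBr; congr (_ * _).
rewrite Mop_sum -sumrB.
pose P i := (Cmat C ^+ N) i nu.
transitivity (\sum_i (\sum_l var k l * (sc n (C l mu i) * mpact (P i) f)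
    - var k i * \sum_l mpact (pd l (P i) * Cmat C l mu) f)).
  apply: eq_bigr => i _; rewrite !MopE -/(P i) mpact_sumr !mulr_sumr -!sumrB.
  apply: eq_bigr => l _; rewrite !mpact_varM pd_Cmat /sc mpact_mpC.
  by rewrite -!mpactM [P i * _]mulrC; ring.
rewrite sumrB exchange_big -sumrB; apply: eq_bigr => l _.
rewrite /chi_term /= mpactD_l mpactN_l !mpact_suml mulrBr; congr (_ - _).
by rewrite mulr_sumr; apply: eq_bigr => i _; rewrite /sc mpact_mpCM.
Qed.

Hypothesis Canti : forall l i j, C l i j = - C l j i.
Hypothesis Cjacobi : forall i j m l,
  \sum_(s < n) (C s i j * C l s m + C s j m * C l s i + C s m i * C l s j) = 0.

(* [chi_term C N] carries the (N-1)-st power of [Cmat C]; hence the shifts below. *)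
Lemma chi_term1 l mu nu : chi_term C 1 l mu nu = sc n (C l mu nu).
Proof.
rewrite /chi_term expr0 (bigD1 nu) //= mxE eqxx mulr1.
rewrite big1 => [|a /negPf neq_a]; last by rewrite mxE neq_a mulr0.
rewrite big1 ?subr0 ?addr0 // => a _; rewrite mxE.
suff -> : pd a ((l == nu)%:R) = 0 :> mpoly k n by rewrite mul0r.
case: (l == nu); last exact: mpD0.
by rewrite /pd -(mpC1 k n) mpD_mpC.
Qed.

(** With [y] the sum of [d^r x_r], column [t] of [Cmat] is [[x_t, y]], and this is the Jacobi
    identity [[x_mu, [x_b, y]] - [x_b, [x_mu, y]] = [[x_mu, x_b], y]]. *)
Lemma jacobi_Cmat l mu b :
  \sum_(a < n) sc n (C l mu a) * Cmat C a b - \sum_(a < n) sc n (C l b a) * Cmat C a mu =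
  \sum_(t < n) Cmat C l t * sc n (C t mu b).
Proof.
have dist (c : 'I_n -> k) (d : 'I_n -> 'I_n -> k) :
    \sum_(a < n) sc n (c a) * (\sum_(r < n) sc n (d a r) * var k r) =
    \sum_(r < n) sc n (\sum_(a < n) c a * d a r) * var k r.
  under eq_bigr => a _ do rewrite mulr_sumr.
  rewrite exchange_big; apply: eq_bigr => r _ /=.
  rewrite /sc (big_morph _ (@mpCD k n) (@mpC0 k n)) mulr_suml.
  by apply: eq_bigr => a _; rewrite mpCM mulrA.
have distC e (x : 'I_n -> k) : \sum_(a < n) sc n (x a) * Cmat C a e =
    \sum_(r < n) sc n (\sum_(a < n) x a * C a e r) * var k r.
  by rewrite -dist; apply: eq_bigr => a _; rewrite mxE.
have -> : \sum_(t < n) Cmat C l t * sc n (C t mu b) =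
    \sum_(r < n) sc n (\sum_(t < n) C t mu b * C l t r) * var k r.
  by rewrite -dist; apply: eq_bigr => t _; rewrite mulrC mxE.
rewrite !distC -sumrB; apply: eq_bigr => r _; rewrite -mulrBl; congr (_ * _).
rewrite /sc; apply/(@addIr _ (mpC n (\sum_(a < n) C l b a * C a mu r))).
rewrite subrK -mpCD; congr mpC; rewrite -big_split; apply/eqP.
rewrite -subr_eq0 -sumrB -oppr_eq0 -sumrN; apply/eqP.
rewrite -[RHS](Cjacobi mu b r l); apply: eq_bigr => s _ /=.
by rewrite (Canti l s mu) (Canti s r mu) (Canti l s b); ring.
Qed.

(** One factor [Cmat] is split off the power. By Leibniz, the terms differentiating it join the
    undifferentiated ones in [jacobi_Cmat]; the others already carry [Cmat] on the left. *)
Lemma chi_termS N l mu nu :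
  chi_term C N.+2 l mu nu = \sum_(t < n) Cmat C l t * chi_term C N.+1 t mu nu.
Proof.
rewrite /chi_term /=; set P := Cmat C ^+ N.
have PSE i : (Cmat C ^+ N.+1) i nu = \sum_b Cmat C i b * P b nu by rewrite exprS mxE.
transitivity (\sum_b (\sum_(a < n) sc n (C l mu a) * Cmat C a b -
     \sum_(a < n) sc n (C l b a) * Cmat C a mu) * P b nu
   - \sum_b Cmat C l b * \sum_(a < n) pd a (P b nu) * Cmat C a mu).
  under [X in _ - X = _]eq_bigr => a _.
    rewrite PSE pd_sum.
    under eq_bigr => b _ do rewrite /pd mpDM -!/(pd a _) pd_Cmat.
    rewrite big_split mulrDl /= !mulr_suml; over.
  rewrite big_split opprD addrA /=; congr (_ - _); last first.
    rewrite exchange_big; apply: eq_bigr => b _ /=.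
    by rewrite mulr_sumr; apply: eq_bigr => a _; rewrite mulrA.
  under [RHS]eq_bigr => b _ do rewrite mulrBl !mulr_suml.
  rewrite sumrB; congr (_ - _); rewrite [RHS]exchange_big.
    by apply: eq_bigr => a _; rewrite PSE mulr_sumr; apply: eq_bigr => b _; rewrite mulrA.
  by apply: eq_bigr => a _; apply: eq_bigr => b _; rewrite mulrAC.
under [RHS]eq_bigr => t _ do rewrite mulrBr.
rewrite sumrB; congr (_ - _).
under eq_bigr => b _ do rewrite jacobi_Cmat mulr_suml.
rewrite exchange_big; apply: eq_bigr => t _; rewrite mulr_sumr.
by apply: eq_bigr => b _; rewrite mulrA.
Qed.

End Commutator.

(** * The commutation formula, with chi read through its truncations *)

Theorem theorem8p4 (k : fieldType) (n : nat) (C : 'I_n -> 'I_n -> 'I_n -> k)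
  (B : nat -> k)
  (char0 : [pchar k] =i pred0)
  (Canti : forall l i j, C l i j = - C l j i)
  (Cjacobi : forall i j m l,
     \sum_(s < n) (C s i j * C l s m + C s j m * C l s i + C s m i * C l s j) = 0)
  (HB : is_bernoulli B)
  (A : algType k) (iota : 'I_n -> A)
  (Hlie : forall i j, iota i * iota j - iota j * iota i = \sum_(l < n) C l i j *: iota l)
  (HPBW : bijective (xi iota))
  (f : mpoly k n) (mu nu : 'I_n) (s1 s2 : mpoly k n) :
  is_star iota (var k nu) f s1 ->
  is_star iota (var k nu) (Mop C mu f) s2 ->
  exists K0 : nat, forall K : nat, (K0 <= K)%N ->
    Mop C mu s1 - s2 =
      (\sum_(l < n) sc n (C l mu nu) * var k l) * f
      + \sum_(t < n) Mop C t (mpact (chi_trunc C B K t mu nu) f).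
Proof.
have xi_var : xi iota (var k nu) = iota nu.
  pose d i : k := (i == nu)%:R.
  have -> : var k nu = linform d ^+ 1.
    rewrite expr1 /linform (bigD1 nu) //= big1 => [|i /negPf neq_i].
      by rewrite /d eqxx /sc mpC1 mul1r addr0.
    by rewrite /d neq_i /sc mpC0 mul0r.
  rewrite xi_linform_pow // expr1 /linform_in (bigD1 nu) //= big1 => [|i /negPf neq_i].
    by rewrite /d eqxx scale1r addr0.
  by rewrite /d neq_i scale0r.
have [K1 xi_f] := xi_left_mul char0 HB Hlie nu f.
have [K2 xi_Mf] := xi_left_mul char0 HB Hlie nu (Mop C mu f).
rewrite /is_star xi_var => def_s1 def_s2.
exists (maxn K1 K2) => K; rewrite geq_max => /andP[le_K1 le_K2].
(* Of the [K.+1] terms, [N = 0] is split off below, and [N = 1, ..., K] match the range of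
   [chi_trunc] at [K]. *)
rewrite -(xi_f K.+1 (leqW le_K1)) in def_s1.
rewrite -(xi_Mf K.+1 (leqW le_K2)) in def_s2.
(* Injectivity of [xi] identifies both star products with the truncated series. *)
rewrite (bij_inj HPBW def_s1) (bij_inj HPBW def_s2) Mop_commutator big_ord_recl.
congr (_ + _).
  have B0 : B 0%N = 1.
    by have := HB 0%N; rewrite big_ord1 subn0 mulr1 divr1.
  rewrite /left_coef /= expr0 B0 mul1r divr1 /sc mpC1 mul1r mulr_suml.
  apply: eq_bigr => l _; rewrite chi_term1 /sc mpact_mpC; ring.
transitivity (\sum_(l < n) \sum_(N < K) sc n (left_coef B N.+1) *
    (var k l * mpact (chi_term C N.+2 l mu nu) f)).
  by rewrite exchange_big; apply: eq_bigr => N _; rewrite mulr_sumr.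
transitivity (\sum_(l < n) \sum_(t < n)
    var k l * mpact (Cmat C l t) (mpact (chi_trunc C B K t mu nu) f)); last first.
  by rewrite exchange_big; apply: eq_bigr => t _; rewrite MopE.
apply: eq_bigr => l _; rewrite -mulr_sumr.
(* The recurrence extracts a factor [Cmat C l t] from every remaining term; together with [x_l] it
   rebuilds [Mop C t] in the form of [MopE]. *)
under eq_bigr => N _ do rewrite mulrCA -mpact_mpCM chi_termS //.
rewrite -mulr_sumr -mpact_suml; congr (_ * _).
under [RHS]eq_bigr => t _ do rewrite -mpactM.
rewrite -mpact_suml; congr mpact.
under eq_bigr => N _ do rewrite mulr_sumr.
rewrite exchange_big; apply: eq_bigr => t _ /=.
rewrite /chi_trunc big_add1 big_mkord mulr_sumr; apply: eq_bigr => N _.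
by rewrite mulrCA.
Qed.
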